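(* Let $k\geq 2$, let $\mathcal{G}=\mathcal{C}_{2k}$ be an even cycle with $s=2k$ edges, let $X$ be the algebraic toric set associated to $\mathcal{G}$ over $K=\mathbb{F}_q$, and let $I(X)\subset K[t_1,\dots,t_s]$ be its vanishing ideal. Then $I(X)$ is generated by the binomials $t_i^{q-1}-t_j^{q-1}$, $1\leq i,j\leq s=2k$, and the binomials $f_\sigma^r$ obtained from all $r\in\{1,\dots,q-2\}$ and all partitions $\sigma=A\sqcup B$ of $\{1,\dots,s\}$ with $|A|=|B|$.
   Context: $K=\mathbb{F}_q$ is a finite field with $q>2$ elements, $K^*=K\setminus\{0\}$, and $\mathbb{P}^{s-1}$ is the projective space of dimension $s-1$ over $K$. The cycle $\mathcal{C}_{2k}$ has vertices $v_1,\dots,v_{2k}$ and edges $e_i=\{v_i,v_{i+1}\}$ for $1\le i\le 2k-1$, $e_{2k}=\{v_{2k},v_1\}$; $s=2k$. For $\mathbf{x}=(x_1,\dots,x_{2k})\in(K^* )^{2k}$ and $e_i=\{v_j,v_l\}$ put $\mathbf{x}^{e_i}=x_jx_l$. The algebraic toric set associated to $\mathcal{G}$ is $X=\{[(\mathbf{x}^{e_1},\dots,\mathbf{x}^{e_s})]:\mathbf{x}\in(K^* )^{2k}\}\subset\mathbb{P}^{s-1}$, and $I(X)\subset S=K[t_1,\dots,t_s]$ is the ideal generated by the homogeneous polynomials vanishing on $X$. For $a\in\mathbb{N}^s$, $t^a=t_1^{a_1}\cdots t_s^{a_s}$ and $\operatorname{supp}(a)=\{i:a_i\ne0\}$. For $r\in\{1,\dots,q-2\}$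 put $\hat r=q-1-r$. For a partition $\sigma=A\sqcup B$ of $\{1,\dots,s\}$ and $r\in\{1,\dots,q-2\}$, the function $\rho_\sigma^r\colon\{1,\dots,s\}\to\{r,\hat r\}$ is defined recursively by $\rho_\sigma^r(1)=r$ and, for $1\le i\le s-1$, $\rho_\sigma^r(i+1)=\widehat{\rho_\sigma^r(i)}$ if $\{i,i+1\}\subset A$ or $\{i,i+1\}\subset B$, and $\rho_\sigma^r(i+1)=\rho_\sigma^r(i)$ otherwise. Naming the parts so that $1\in A$, $f_\sigma^r$ is the unique binomial $t^a-t^b$ with $\operatorname{supp}(a)=A$, $\operatorname{supp}(b)=B$, $a_i=\rho_\sigma^r(i)$ for $i\in A$ and $b_j=\rho_\sigma^r(j)$ for $j\in B$. *)

(* Defs.v *)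
From HB Require Import structures.
From mathcomp Require Import all_boot all_order all_algebra.
From mathcomp Require Import mpoly.

Set Implicit Arguments.
Unset Strict Implicit.
Unset Printing Implicit Defensive.

Import GRing.Theory.
Local Open Scope ring_scope.

(* Indices are shifted down by one: i : 'I_n stands for i + 1 in {1, ..., n}. *)

Section Projective.
Variables (K : fieldType) (n : nat).

(* The points of P^(n-1) are the lines of K^n, with [v] = <[v]>%VS. *)
Definition proj_space := {L : {vspace 'rV[K]_n} | \dim L == 1%N}.

(* For p homogeneous, the choice of the representative v is irrelevant. *)
Definition vanishes_at (p : {mpoly K[n]}) (P : proj_space) : Prop :=
  forall v : 'rV[K]_n, v \in val P -> v != 0 -> p.@[fun i => v 0 i] = 0.

Definition ideal_gen (G : {mpoly K[n]} -> Prop) (p : {mpoly K[n]}) : Prop :=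
  exists (m : nat) (c g : 'I_m -> {mpoly K[n]}),
    (forall i, G (g i)) /\ p = \sum_(i < m) c i * g i.

Definition vanishing_ideal (X : proj_space -> Prop) : {mpoly K[n]} -> Prop :=
  ideal_gen (fun p => (exists d : nat, p \is d.-homog) /\
                      (forall P, X P -> vanishes_at p P)).

(* The edges of the graph on the vertex set V are e 0, ..., e (n - 1). *)
Definition toric_set (V : finType) (e : 'I_n -> {set V}) (P : proj_space) :
    Prop :=
  exists x : V -> K, (forall v, x v != 0) /\
    val P = <[\row_(i < n) \prod_(v in e i) x v]>%VS.

End Projective.

(* ordS is the cyclic successor of 'I_n. *)
Definition cycle_edge (n : nat) (i : 'I_n) : {set 'I_n} := [set i; ordS i].

Section Binomials.
Variables (K : finFieldType) (n : nat).
Local Notation q := #|K|.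

Definition hat (r : nat) : nat := (q - 1 - r)%N.

(* Meaningful for i < n: then the set [set j | ...] below is {i, i + 1}. *)
Fixpoint rho (A B : {set 'I_n}) (r i : nat) : nat :=
  if i is i'.+1 then
    let I := [set j : 'I_n | (val j == i') || (val j == i'.+1)] in
    if (I \subset A) || (I \subset B) then hat (rho A B r i')
    else rho A B r i'
  else r.

Definition f_sigma (A B : {set 'I_n}) (r : nat) : {mpoly K[n]} :=
  'X_[ [multinom if i \in A then rho A B r i else 0%N | i < n] ]
  - 'X_[ [multinom if i \in B then rho A B r i else 0%N | i < n] ].

Definition cycle_generator (p : {mpoly K[n]}) : Prop :=
  (exists i j : 'I_n, p = 'X_i ^+ (q - 1)%N - 'X_j ^+ (q - 1)%N) \/
  (exists (r : nat) (A B : {set 'I_n}),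
    [/\ (1 <= r <= q - 2)%N,
        A :|: B = [set: 'I_n] /\ [disjoint A & B],
        #|A| = #|B|,
        exists2 i, i \in A & val i = 0%N
      & p = f_sigma A B r]).

End Binomials.

(* Main.v *)
Require Import Defs.
From mathcomp Require Import all_boot all_order all_algebra all_field.
From mathcomp Require Import mpoly zify ring.

(* Put N = q - 1, n = 2k, and for 0 <= r < N let e be the alternating vector
   (r, N - r, r, N - r, ...), of total degree kN. A homogeneous p in I(X)
   vanishes at all points (x_i x_{i+1})_i with x in the torus; multiplying by
   characters of the torus and summing over it shows that the coefficients of p
   over each class of the relation "t^a = t^b on X" sum to 0. Hence p is a
   combination of binomials t^a - t^b with |a| = |b| and t^a = t^b on X, and the
   latter means a = b + e mod N for some r.
   If r = 0, the binomials t_i^N - t_j^N suffice. Otherwise every sigma = A + B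
   with |A| = k has f_sigma^r = t^{e|A} - t^{(N-e)|B} up to sign and r <-> N - r.
   When e <= a on A, this binomial turns t^a into a monomial of the same degree
   with exponents congruent to b. Such an A exists for a, or, with N - e in place
   of e, for b. *)

(** * Arithmetic and finite-set preliminaries *)

Section Preliminaries.

Set Implicit Arguments.
Unset Strict Implicit.

(** Here [d - m %% d] represents -m modulo d without truncated subtraction. *)
Lemma dvdn_subn_mod (d a m : nat) :
  (0 < d)%N -> (d %| d - m %% d + a)%N = (a == m %[mod d])%N.
Proof.
move=> d_gt0; rewrite /dvdn -[X in _ == X](mod0n d) -(eqn_modDl (m %% d)).
by rewrite addnA subnKC ?modnDl ?addn0 ?modn_mod // ltnW // ltn_mod.
Qed.

Lemma sub_card_ex (T : finType) (B : {set T}) m :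
  (m <= #|B|)%N -> exists2 A : {set T}, A \subset B & #|A| = m.
Proof.
case/card_geqP => s [us sz sB]; exists [set x in s].
  by apply/subsetP => x; rewrite inE => /sB.
by rewrite cardsE (card_uniqP us).
Qed.

Lemma partition_setC (T : finType) (A B : {set T}) :
  A :|: B = [set: T] -> [disjoint A & B] -> B = ~: A.
Proof.
move=> AB dAB; apply/setP => i; rewrite inE; have := in_setT i; rewrite -AB inE.
by case Ai: (i \in A) => //= _; rewrite (disjointFr dAB Ai).
Qed.

End Preliminaries.

(** * Congruence modulo a generated ideal *)

Section IdealGen.

Set Implicit Arguments.
Unset Strict Implicit.
Local Open Scope ring_scope.
Import GRing.Theory.

Variables (K : fieldType) (n : nat) (G : {mpoly K[n]} -> Prop).
Implicit Types p q u v : {mpoly K[n]}.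

Lemma ideal_gen0 : ideal_gen G 0.
Proof.
by exists 0%N, (fun=> 0), (fun=> 0); split=> [[]|]; rewrite ?big_ord0.
Qed.

Lemma ideal_gen_mem {p} : G p -> ideal_gen G p.
Proof.
by move=> Gp; exists 1%N, (fun=> 1), (fun=> p); rewrite big_ord1 mul1r.
Qed.

Lemma ideal_genM u {p} : ideal_gen G p -> ideal_gen G (u * p).
Proof.
move=> [m [c [g [Gg ->]]]]; exists m, (fun i => u * c i), g; split=> //.
by rewrite mulr_sumr; apply: eq_bigr => i _; rewrite mulrA.
Qed.

Lemma ideal_genN {p} : ideal_gen G p -> ideal_gen G (- p).
Proof. by rewrite -mulN1r; apply: ideal_genM. Qed.

Lemma ideal_genD {p q} : ideal_gen G p -> ideal_gen G q -> ideal_gen G (p + q).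
Proof.
move=> [m [c [g [Gg ->]]]] [m' [c' [g' [Gg' ->]]]].
exists (m + m')%N.
exists (fun i => match split i with inl j => c j | inr j => c' j end).
exists (fun i => match split i with inl j => g j | inr j => g' j end).
split=> [i|]; first by case: (split i).
rewrite big_split_ord /=; congr (_ + _); apply: eq_bigr => i _.
  by have /= -> := unsplitK (inl i : 'I_m + 'I_m').
by have /= -> := unsplitK (inr i : 'I_m + 'I_m').
Qed.

Lemma ideal_gen_sum (I : Type) (r : seq I) (P : pred I) (F : I -> {mpoly K[n]}) :
  (forall i, P i -> ideal_gen G (F i)) -> ideal_gen G (\sum_(i <- r | P i) F i).
Proof.
by move=> GF; apply: big_ind => //; [apply: ideal_gen0|apply: @ideal_genD].
Qed.

Definition congr_mod p q := ideal_gen G (p - q).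

Lemma congr_mod_refl p : congr_mod p p.
Proof. by rewrite /congr_mod subrr; apply: ideal_gen0. Qed.

Lemma congr_mod_sym {p q} : congr_mod p q -> congr_mod q p.
Proof. by move=> /ideal_genN; rewrite opprB. Qed.

Lemma congr_mod_trans {q p u} : congr_mod p q -> congr_mod q u -> congr_mod p u.
Proof. by move=> pq qu; have := ideal_genD pq qu; rewrite addrA subrK. Qed.

Lemma congr_modM {p q u v} :
  congr_mod p q -> congr_mod u v -> congr_mod (p * u) (q * v).
Proof.
move=> pq uv; rewrite /congr_mod.
have -> : p * u - q * v = u * (p - q) + q * (u - v) by ring.
by apply: ideal_genD; apply: ideal_genM.
Qed.

Lemma congr_modX {p q} m : congr_mod p q -> congr_mod (p ^+ m) (q ^+ m).
Proof.
move=> pq; elim: m => [|m IHm]; first exact: congr_mod_refl.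
by rewrite !exprS; apply: congr_modM.
Qed.

Lemma congr_mod_prod (I : Type) (r : seq I) (F F' : I -> {mpoly K[n]}) :
  (forall i, congr_mod (F i) (F' i)) ->
  congr_mod (\prod_(i <- r) F i) (\prod_(i <- r) F' i).
Proof.
by move=> FF'; apply: (big_ind2 congr_mod);
  [apply: congr_mod_refl | move=> *; apply: congr_modM |].
Qed.

(** Fix a monomial t^m in a fibre of [h]. As the coefficients over the fibre sum to 0, replacing
    each t^a there by t^a - t^m does not change that part of p. *)
Lemma ideal_gen_fibres (T : finType) (h : 'X_{1..n} -> T) p :
  (forall m, m \in msupp p -> \sum_(a <- msupp p | h a == h m) p@_a = 0) ->
  (forall a b, a \in msupp p -> b \in msupp p -> h a = h b ->
     congr_mod 'X_[a] 'X_[b]) ->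
  ideal_gen G p.
Proof.
move=> sum0 congr_fibre; rewrite [p]mpolyE (partition_big h predT) //=.
apply: ideal_gen_sum => c _.
have [/hasP[m pm /eqP hm]|/hasPn h_neq] :=
  boolP (has (fun a => h a == c) (msupp p)); last first.
  rewrite big_seq_cond big_pred0; first exact: ideal_gen0.
  by move=> a; apply/negP => /andP[/h_neq /negP].
have -> : \sum_(a <- msupp p | h a == c) p@_a *: 'X_[a] =
          \sum_(a <- msupp p | h a == c) (p@_a)%:MP * ('X_[a] - 'X_[m]).
  under [RHS]eq_bigr => a _ do rewrite mulrBr !mul_mpolyC.
  by rewrite sumrB -scaler_suml -hm sum0 // scale0r subr0.
rewrite big_seq_cond; apply: ideal_gen_sum => a /andP[pa /eqP ha].
by apply: ideal_genM; apply: congr_fibre => //; rewrite ha hm.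
Qed.

End IdealGen.

(** * Power sums over the torus of a finite field *)

Section PowerSums.

Set Implicit Arguments.
Unset Strict Implicit.
Local Open Scope ring_scope.
Import GRing.Theory.

Variable K : finFieldType.
Local Notation N := (#|K| - 1)%N.

Lemma finField_expf_unit (x : K) : x != 0 -> x ^+ N = 1.
Proof.
move=> x0; apply: (mulfI x0).
by rewrite -exprS subn1 prednK ?mulr1 ?expf_card // (cardD1 x).
Qed.

Lemma finField_expf_mod (x : K) (a b : nat) :
  x != 0 -> a = b %[mod N] -> x ^+ a = x ^+ b.
Proof.
move=> x0 ab; rewrite (divn_eq a N) (divn_eq b N) ab !exprD !(mulnC _ N).
by rewrite !exprM finField_expf_unit // !expr1n.
Qed.

Lemma finField_sum_exp (j : nat) :
  \sum_(x : K | x != 0) x ^+ j = if (N %| j)%N then -1 else 0.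
Proof.
have cardN : #|[pred x : K | x != 0]| = N by rewrite subn1 cardC1.
have N_gt0 : (0 < N)%N by rewrite -cardN (cardD1 1) !inE oner_neq0.
case: ifPn => [/dvdnP[m ->]|Nj].
  under eq_bigr => x x0 do rewrite mulnC exprM finField_expf_unit // expr1n.
  rewrite sumr_const cardN; apply/eqP; rewrite -subr_eq0 opprK -mulrSr.
  rewrite subn1 prednK; last by rewrite (cardD1 1).
  (* Translation by 1 permutes K, so #|K| copies of 1 add up to 0, that is, N = -1 in K. *)
  have /eqP : \sum_(x : K) x = \sum_(x : K) (x + 1).
    exact: (reindex_inj (addIr 1)).
  by rewrite /= big_split /= -subr_eq0 opprD addNKr oppr_eq0 sumr_const.
have [y /andP[y0 yj]|unity] := pickP [pred y : K | (y != 0) && (y ^+ j != 1)].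
  (* Multiplication by y permutes the nonzero elements, so the sum is unchanged when multiplied by
     y^j. *)
  suff /eqP : (y ^+ j - 1) * \sum_(x : K | x != 0) x ^+ j = 0.
    by rewrite mulf_eq0 subr_eq0 (negPf yj) => /eqP.
  apply/eqP; rewrite mulrBl mul1r subr_eq0 mulr_sumr eq_sym; apply/eqP.
  rewrite (reindex_onto (fun x => y * x) (fun x => y^-1 * x)) /=.
    apply: eq_big => [x|x _]; last by rewrite exprMn.
    by rewrite mulf_eq0 (negPf y0) mulKf // eqxx andbT.
  by move=> x _; rewrite mulVKf.
have jmod : (0 < j %% N)%N by rewrite lt0n.
(* If x^j = 1 for all N nonzero x, they are all roots of unity for the exponent j mod N, which lies
   strictly between 0 and N: too many roots. *)
have := @max_unity_roots K _ (enum [pred x : K | x != 0]) jmod.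
rewrite -cardE cardN leqNgt ltn_pmod // enum_uniq => H.
suff /H/(_ isT) : all (j %% N).-unity_root (enum [pred x : K | x != 0]) by [].
apply/allP => x; rewrite mem_enum inE => x0; apply/unity_rootP.
rewrite (@finField_expf_mod _ _ j) ?modn_mod //.
by have /= := unity x; rewrite x0 => /negbFE/eqP.
Qed.

Lemma finField_torus_sum_exp (n : nat) (a : 'I_n -> nat) :
  \sum_(x in ffun_on [pred y : K | y != 0]) \prod_i x i ^+ a i =
  if [forall i, (N %| a i)%N] then (-1) ^+ n else 0.
Proof.
rewrite -(bigA_distr_big _ (fun i y => y ^+ a i)) /=.
under eq_bigr => i _ do rewrite finField_sum_exp.
case: ifPn => [/forallP aN|/forallPn[i /negPf aN]].
  under eq_bigr => i _ do rewrite aN.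
  by rewrite prodr_const card_ord.
by rewrite (bigD1 i) //= aN mul0r.
Qed.

End PowerSums.

(** * Alternating exponent vectors r, N - r, r, .. *)

Section Alternating.

Set Implicit Arguments.
Unset Strict Implicit.
Implicit Types (N r k : nat).

Definition alt N r (i : nat) := if odd i then N - r else r.

Lemma alt_hat N r (i : nat) : r <= N -> alt N (N - r) i = N - alt N r i.
Proof. by rewrite /alt => rN; case: ifP => _; rewrite ?subKn. Qed.

Lemma alt_leq {N r} (i : nat) : r <= N -> alt N r i <= N.
Proof. by rewrite /alt => rN; case: ifP => _; rewrite ?leq_subr. Qed.

Lemma sum_alt k N r : r <= N -> \sum_(i < 2 * k) alt N r i = k * N.
Proof.
move=> rN; elim: k => [|k IHk]; first by rewrite muln0 big_ord0.
rewrite mulnS !big_ord_recr /= IHk /alt /= oddM /= addnAC -addnA subnK //.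
by rewrite mulSnr.
Qed.

Lemma alt_ord_pred k N r (i : 'I_(2 * k)) :
  r <= N -> alt N r i + alt N r (ord_pred i) = N.
Proof.
move=> rN; have i_lt := ltn_ord i; rewrite /alt /= odd_mod ?oddM //.
have -> : odd (i + 2 * k).-1 = ~~ odd i by lia.
by case: (odd i); rewrite /= ?subnK ?subnKC.
Qed.

(** Modulo N the difference a - b changes sign from each index to the next, so it is determined by
    its value r at index 0. *)
Lemma alternating_diff k N (a b : 'I_(2 * k) -> nat) : 0 < k -> 0 < N ->
  (forall i, a i + a (ord_pred i) = b i + b (ord_pred i) %[mod N]) ->
  exists2 r, r < N & forall i, a i = b i + alt N r i %[mod N].
Proof.
move=> k_gt0 N_gt0 ab; have n_gt0 : 0 < 2 * k by rewrite muln_gt0.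
pose o : 'I_(2 * k) := Ordinal n_gt0; pose r := (a o + (N - b o %% N)) %% N.
have r_lt : r < N by rewrite ltn_mod.
exists r => // -[m m_lt]; elim: m m_lt => [|m IHm] m_lt.
  have -> : Ordinal m_lt = o by apply: val_inj.
  rewrite /alt /= modnDmr -modnDml addnCA.
  by rewrite subnKC ?modnDr // ltnW // ltn_mod.
set i := Ordinal m_lt; pose j := Ordinal (ltnW m_lt).
have pred_i : ord_pred i = j.
  by apply: val_inj; rewrite /= modnDr modn_small // ltnW.
have /eqP e := ab i; rewrite pred_i in e.
apply/eqP; rewrite -(eqn_modDr (b j + alt N r j)).
rewrite -modnDmr -(IHm (ltnW m_lt)) modnDmr (eqP e).
have alt_ij : alt N r i + alt N r j = N by rewrite -pred_i alt_ord_pred // ltnW.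
by rewrite addnACA alt_ij modnDr.
Qed.

End Alternating.

(** * Congruences of monomials modulo the cycle generators *)

Section CycleIdeal.

Set Implicit Arguments.
Unset Strict Implicit.
Local Open Scope ring_scope.
Import GRing.Theory.

Variables (K : finFieldType) (k : nat).
Local Notation n := (2 * k)%N.
Local Notation N := (#|K| - 1)%N.
Local Notation "p ~ q" := (congr_mod (@cycle_generator K n) p q)
  (at level 70).
Implicit Types (A : {set 'I_n}) (r : nat) (a b : 'X_{1..n}).

(** From i to i + 1, [alt] always swaps r and N - r, while [rho] does so only within one part. Hence
    their agreement toggles exactly when membership in A changes. *)
Lemma rho_alt A r (o i : 'I_n) : val o = 0%N -> (r <= N)%N ->
  rho K A (~: A) r i =
  if (i \in A) (+) (o \in A) then (N - alt N r i)%N else alt N r i.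
Proof.
move=> o0 rN; case: i => m m_lt /=.
elim: m m_lt => [|m IHm] m_lt.
  by rewrite (_ : Ordinal m_lt = o) ?addbb //; apply: val_inj.
set i := Ordinal m_lt; pose j := Ordinal (ltnW m_lt).
have -> : rho K A (~: A) r m.+1 =
   if (j \in A) == (i \in A) then hat K (rho K A (~: A) r m)
   else rho K A (~: A) r m.
  rewrite /=; congr (if _ then _ else _).
  set I := [set x | _]; have -> : I = [set j; i].
    by apply/setP => x; rewrite !inE -!val_eqE.
  rewrite !subUset !sub1set !inE.
  by case: (j \in A); case: (i \in A).
rewrite /hat (IHm (ltnW m_lt)).
by rewrite -/j /alt /=; case: (j \in A); case: (i \in A); case: (o \in A);
  case: (odd m) => //=; rewrite ?subKn ?leq_subr.
Qed.

Definition alt_part A r : 'X_{1..n} :=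
  [multinom if i \in A then alt N r i else 0%N | i < n].

Lemma f_sigma_alt A r o : (r <= N)%N -> o \in A -> val o = 0%N ->
  f_sigma K A (~: A) r = 'X_[alt_part A r] - 'X_[alt_part (~: A) (N - r)].
Proof.
move=> rN Ao o0; rewrite /f_sigma; congr ('X_[_] - 'X_[_]).
all: apply/mnmP => i; rewrite !mnmE ?inE; case: ifP => // Ai.
all: rewrite (rho_alt _ _ o0) // Ao.
  by rewrite Ai.
by move/negPf: Ai => ->; rewrite alt_hat.
Qed.

(** Adding the sum of e over the complement of A makes both degrees kN: the left one becomes the
    total of e, the right one N for each of the k indices outside A. *)
Lemma mdeg_alt_part A r : (r <= N)%N -> #|A| = k ->
  mdeg (alt_part A r) = mdeg (alt_part (~: A) (N - r)).
Proof.
move=> rN cardA; rewrite !mdegE.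
have -> : (\sum_i alt_part A r i = \sum_(i in A) alt N r i)%N.
  by rewrite [RHS]big_mkcond /=; apply: eq_bigr => i _; rewrite mnmE.
have -> : (\sum_i alt_part (~: A) (N - r) i =
         \sum_(i in ~: A) alt N (N - r) i)%N.
  by rewrite [RHS]big_mkcond /=; apply: eq_bigr => i _; rewrite mnmE.
have cardCA : #|~: A| = k by have := cardsC A; rewrite cardA card_ord; lia.
have sumE : (\sum_(i in A) alt N r i + \sum_(i in ~: A) alt N r i = k * N)%N.
  rewrite -(@sum_alt k N r) // [RHS](bigID (mem A)) /=; congr addn.
  by apply: eq_bigl => i; rewrite inE.
apply: (@addIn (\sum_(i in ~: A) alt N r i)); rewrite sumE -big_split /=.
rewrite -[in LHS]cardCA -sum_nat_const; apply: eq_bigr => i _.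
by rewrite alt_hat // subnK // alt_leq.
Qed.

Lemma alt_part_congr A r : (0 < k)%N -> (0 < r < N)%N -> #|A| = k ->
  'X_[alt_part A r] ~ 'X_[alt_part (~: A) (N - r)].
Proof.
move=> k_gt0 /andP[r_gt0 rN] cardA.
have n_gt0 : (0 < n)%N by rewrite muln_gt0.
(* The generators require index 0 to lie in A; exchanging A with its complement and r with N - r
   only swaps the two monomials. *)
wlog A0 : A r r_gt0 rN cardA / Ordinal n_gt0 \in A => [wlog0|].
  have [|A0] := boolP (Ordinal n_gt0 \in A); first exact: wlog0.
  rewrite -{1}(setCK A) -{1}(subKn (ltnW rN)); apply: congr_mod_sym.
  apply: wlog0; rewrite ?inE //; first lia; first lia.
  by have := cardsC A; rewrite cardA card_ord; lia.
apply: ideal_gen_mem; right; exists r, A, (~: A); split.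
- lia.
- by rewrite setUCr -setI_eq0 setICr.
- by have := cardsC A; rewrite cardA card_ord; lia.
- by exists (Ordinal n_gt0).
by rewrite (@f_sigma_alt A r (Ordinal n_gt0)) // ltnW.
Qed.

(** Every t_i^N may be replaced by z, the N-th power of the first variable. What remains of t^c is
    its residues mod N and the number of factors z; equal degrees and residues force equal
    numbers. *)
Lemma congr_monomials_mod a b : (0 < k)%N -> (0 < N)%N ->
  mdeg a = mdeg b -> (forall i, a i = b i %[mod N]) -> 'X_[a] ~ 'X_[b].
Proof.
move=> k_gt0 N_gt0 ab modab.
have n_gt0 : (0 < n)%N by rewrite muln_gt0.
pose z : {mpoly K[n]} := 'X_(Ordinal n_gt0) ^+ N.
have normal c : 'X_[c] ~ \prod_i 'X_i ^+ (c i %% N) * z ^+ (\sum_i c i %/ N).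
  have -> : 'X_[c] = \prod_i ('X_i ^+ (c i %% N) * ('X_i ^+ N) ^+ (c i %/ N))
    :> {mpoly K[n]}.
    rewrite mpolyXE_id; apply: eq_bigr => i _.
    by rewrite -exprM -exprD {1}(divn_eq (c i) N) addnC (mulnC N).
  rewrite big_split /=; apply: congr_modM; first exact: congr_mod_refl.
  rewrite -prodrXr; apply: congr_mod_prod => i; apply: congr_modX.
  by apply: ideal_gen_mem; left; exists i, (Ordinal n_gt0).
apply: congr_mod_trans (normal a) _; apply: congr_mod_sym.
under [X in _ ~ X * _]eq_bigr => i _ do rewrite modab.
suff -> : (\sum_i a i %/ N = \sum_i b i %/ N)%N by exact: normal.
apply/eqP; rewrite -(eqn_pmul2r N_gt0) !big_distrl /=.
rewrite -(eqn_add2r (\sum_i a i %% N)) -big_split /=.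
under [X in (_ + X)%N]eq_bigr => i _ do rewrite modab.
rewrite -big_split /=; apply/eqP.
transitivity (mdeg a); last rewrite ab.
all: by rewrite mdegE; apply: eq_bigr => i _; rewrite -divn_eq.
Qed.

Lemma congr_monomials_alt_part a b A r : (0 < k)%N -> (0 < r < N)%N ->
  mdeg a = mdeg b -> (forall i, a i = b i + alt N r i %[mod N]) ->
  #|A| = k -> {in A, forall i : 'I_n, alt N r i <= a i}%N ->
  'X_[a] ~ 'X_[b].
Proof.
move=> k_gt0 rbnd ab modab cardA Aa; have /andP[r_gt0 rN] := rbnd.
have N_gt0 : (0 < N)%N by lia.
have le_a : (alt_part A r <= a)%MM.
  by apply/mnm_lepP => i; rewrite mnmE; case: ifP => // /Aa.
rewrite -(submK le_a).
set c := (a - _)%MM.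
(* On A the exponents drop by e_i, off A they rise by N - e_i; both are subtraction of e_i modulo
   N. *)
apply: (@congr_mod_trans _ _ _ 'X_[c + alt_part (~: A) (N - r)]).
  rewrite !mpolyXD; apply: congr_modM; first exact: congr_mod_refl.
  exact: alt_part_congr.
apply: congr_monomials_mod => // [|i].
  by rewrite mdegD -mdeg_alt_part ?(ltnW rN) // -mdegD submK.
rewrite mnmDE /c mnmBE !mnmE inE; case: ifP => Ai /=; apply/eqP.
  by rewrite addn0 -(eqn_modDr (alt N r i)) subnK ?Aa // modab.
rewrite subn0 -modnDml modab modnDml alt_hat ?(ltnW rN) // -addnA subnKC.
  by rewrite modnDr.
exact: alt_leq (ltnW rN).
Qed.

(* Put e = alt N r. Since a_i = b_i + e_i mod N, every index i satisfies
   e_i <= a_i or N - e_i <= b_i, so one of the two holds for k indices. *)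
Lemma congr_monomials a b : (0 < k)%N -> (0 < N)%N -> mdeg a = mdeg b ->
  (forall i, a i + a (ord_pred i) = b i + b (ord_pred i) %[mod N])%N ->
  'X_[a] ~ 'X_[b].
Proof.
move=> k_gt0 N_gt0 ab /(alternating_diff k_gt0 N_gt0)[r rN modab].
have [r0|r_gt0] := posnP r.
  apply: congr_monomials_mod => // i; rewrite modab r0 /alt subn0.
  by case: ifP => _; rewrite ?modnDr ?addn0.
pose B := [set i : 'I_n | alt N r i <= a i]%N.
have [leB|ltB] := leqP k #|B|.
  have [A /subsetP AB cardA] := sub_card_ex leB.
  apply: (@congr_monomials_alt_part _ _ A r) => //; first by rewrite r_gt0.
  by move=> i /AB; rewrite inE.
have [A /subsetP AB cardA] : exists2 A : {set 'I_n}, A \subset ~: B & #|A| = k.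
  apply: sub_card_ex; rewrite -(leq_add2l #|B|) cardsC card_ord [leqRHS]mul2n.
  by rewrite -addnn leq_add2r ltnW.
(* The roles of a and b are exchanged: b = a + (N - e) modulo N. *)
apply: congr_mod_sym.
apply: (@congr_monomials_alt_part _ _ A (N - r)) => //; first lia.
  move=> i; apply/eqP; rewrite alt_hat ?(ltnW rN) //.
  rewrite -(modnDml (a i)) modab modnDml -addnA subnKC ?modnDr //.
  exact: alt_leq (ltnW rN).
move=> i /AB; rewrite !inE -ltnNge alt_hat ?(ltnW rN) // => a_lt.
have e_le : (alt N r i <= N)%N := alt_leq i (ltnW rN).
(* Since a_i < e_i, the number a_i + (N - e_i) is below N; being congruent to b_i, it is the residue
   of b_i. *)
suff b_mod : (b i %% N = a i + (N - alt N r i))%N.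
  by apply: leq_trans (leq_mod (b i) N); rewrite b_mod leq_addl.
rewrite -[RHS](@modn_small _ N); last by rewrite -[ltnRHS](subnKC e_le) ltn_add2r.
rewrite -(modnDml (a i)) modab modnDml -addnA subnKC ?modnDr //.
Qed.

End CycleIdeal.

(** * Polynomials vanishing on the toric set of the cycle *)

Section CycleToric.

Set Implicit Arguments.
Unset Strict Implicit.

Local Open Scope ring_scope.
Import GRing.Theory.

Variables (K : finFieldType) (k : nat).
Local Notation n := (2 * k)%N.
Local Notation N := (#|K| - 1)%N.
Implicit Types (x : 'I_n -> K) (p g : {mpoly K[n]}).

Lemma ordS_neq (i : 'I_n) : i != ordS i.
Proof.
rewrite -val_eqE /=; have i_lt := ltn_ord i.
have [lt_n|ge_n] := ltnP i.+1 n; first by rewrite modn_small // neq_ltn ltnSn.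
have -> : i.+1 = n by apply/eqP; rewrite eqn_leq ge_n andbT.
by rewrite modnn; lia.
Qed.

Lemma prod_cycle_edge x (i : 'I_n) :
  \prod_(v in cycle_edge i) x v = x i * x (ordS i).
Proof. by rewrite big_setU1 ?inE ?ordS_neq //= big_set1. Qed.

(** Vertex i lies on the edges i and i - 1, so t^a pulls back to the torus character with exponents
    a_i + a_(i-1). *)
Lemma prod_edges_exp x (a : 'I_n -> nat) :
  \prod_i (x i * x (ordS i)) ^+ a i = \prod_i x i ^+ (a i + a (ord_pred i)).
Proof.
under eq_bigr => i _ do rewrite exprMn.
rewrite big_split /= [X in _ * X](reindex_inj (can_inj (@ord_predK n))) /=.
rewrite -big_split /=; apply: eq_bigr => i _.
by rewrite ord_predK exprD.
Qed.

Lemma toric_set_rep P (v : 'rV[K]_n) :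
  toric_set (@cycle_edge n) P -> v \in val P -> v != 0 ->
  exists c x, [/\ c != 0, forall i, x i != 0 &
                  forall i, v 0 i = c * (x i * x (ordS i))].
Proof.
move=> [x [x0 ->]] /vlineP[c ->]; rewrite scaler_eq0 negb_or => /andP[c0 _].
by exists c, x; split=> // i; rewrite !mxE prod_cycle_edge.
Qed.

Lemma toric_set_eval_eq0 p x : (0 < k)%N ->
  (forall P, toric_set (@cycle_edge n) P -> vanishes_at p P) ->
  (forall i, x i != 0) -> p.@[fun i => x i * x (ordS i)] = 0.
Proof.
move=> k_gt0 vanp x0; pose y : 'rV[K]_n := \row_i \prod_(v in cycle_edge i) x v.
have n_gt0 : (0 < n)%N by rewrite muln_gt0.
have y0 : y != 0.
  apply/eqP => /rowP/(_ (Ordinal n_gt0))/eqP; rewrite !mxE prod_cycle_edge.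
  by rewrite mulf_eq0 !(negPf (x0 _)).
have dimy : \dim <[y]>%VS == 1%N by rewrite dim_vline y0.
rewrite -(vanp (Sub <[y]>%VS dimy) _ y) ?memv_line //; last by exists x.
by apply: meval_eq => i; rewrite mxE prod_cycle_edge.
Qed.

Lemma cycle_generator_homog p : cycle_generator p -> exists d, p \is d.-homog.
Proof.
move=> [[i [j ->]]|[r [A [B [rN [AB dAB] cardAB [o Ao o0] ->]]]]].
  exists N; rewrite !mpolyXn; apply: rpredB; rewrite dhomogX /=.
    by rewrite mdegMn mdeg1 mul1n.
  by rewrite mdegMn mdeg1 mul1n.
have rN' : (r <= N)%N by lia.
have BE := partition_setC AB dAB.
have cardA : #|A| = k.
  by apply: double_inj; rewrite -addnn {2}cardAB BE cardsC card_ord mul2n.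
rewrite BE (f_sigma_alt rN' Ao o0).
exists (mdeg (alt_part K A r)); apply: rpredB; rewrite dhomogX //=.
by rewrite -mdeg_alt_part.
Qed.

Lemma cycle_generator_vanishes p P : cycle_generator p ->
  toric_set (@cycle_edge n) P -> vanishes_at p P.
Proof.
move=> gen_p XP v Pv v0; have [c [x [c0 x0 vE]]] := toric_set_rep XP Pv v0.
have vN i : v 0 i ^+ N = 1.
  by rewrite finField_expf_unit // vE !mulf_neq0.
have vn0 i : v 0 i != 0 by rewrite vE !mulf_neq0.
case: gen_p => [[i [j ->]]|[r [A [B [rN [AB dAB] cardAB [o Ao o0] ->]]]]].
  by rewrite mevalB !rmorphXn /= !mevalXU !vN subrr.
have rN' : (r <= N)%N by lia.
have BE := partition_setC AB dAB.
rewrite BE (f_sigma_alt rN' Ao o0) mevalB !mevalX.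
(* The monomial t^e is 1 on X: the scalar c contributes c^(kN), and each x_i has exponent e_i +
   e_(i-1) = N. *)
have prod1 : \prod_i v 0 i ^+ alt N r i = 1.
  under eq_bigr => i _ do rewrite vE exprMn.
  rewrite big_split /= prodrXr sum_alt // mulnC exprM finField_expf_unit //.
  rewrite expr1n mul1r prod_edges_exp big1 // => i _.
  by rewrite alt_ord_pred // finField_expf_unit.
apply/eqP; rewrite subr_eq0; apply/eqP.
(* Multiplied by z, the first monomial becomes t^e and the second a product of N-th powers, so both
   are 1. *)
pose z := \prod_i v 0 i ^+ alt_part K (~: A) r i.
have z0 : z != 0 by apply/prodf_neq0 => i _; rewrite expf_neq0.
apply: (mulIf z0); rewrite -!big_split /=.
rewrite [RHS]big1 => [|i _]; last first.
  rewrite -exprD !mnmE inE; case: (i \in A) => //=.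
  by rewrite alt_hat // subnK // alt_leq.
rewrite -[RHS]prod1; apply: eq_bigr => i _; rewrite -exprD !mnmE inE.
by case: (i \in A); rewrite ?addn0.
Qed.

(** Multiply the pullback of g by the inverse of the character of t^m and sum over the torus: only
    the monomials with the character of t^m survive, each with the same factor (-1)^n. *)
Lemma toric_coef_sum_eq0 g (m : 'X_{1..n}) :
  (forall x, (forall i, x i != 0) -> g.@[fun i => x i * x (ordS i)] = 0) ->
  \sum_(a <- msupp g | [forall i, a i + a (ord_pred i) ==
                                  m i + m (ord_pred i) %[mod N]]%N) g@_a = 0.
Proof.
move=> g0; pose e i := (N - (m i + m (ord_pred i)) %% N)%N.
have N_gt0 : (0 < N)%N by rewrite subn_gt0 finNzRing_gt1.
have : \sum_(x in ffun_on [pred y : K | y != 0])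
   (\prod_i x i ^+ e i) * g.@[fun i => x i * x (ordS i)] = 0.
  by rewrite big1 // => x /ffun_onP x0; rewrite g0 ?mulr0.
rewrite (eq_bigr (fun x : {ffun 'I_n -> K} => \sum_(a <- msupp g)
    g@_a * \prod_i x i ^+ (e i + (a i + a (ord_pred i))))); last first.
  move=> x _; rewrite mevalE mulr_sumr; apply: eq_bigr => a _.
  rewrite mulrCA prod_edges_exp -big_split /=; congr (_ * _).
  by apply: eq_bigr => i _; rewrite -exprD.
rewrite exchange_big /=.
under eq_bigr => a _ do rewrite -mulr_sumr finField_torus_sum_exp.
under eq_bigr => a _.
  have -> : [forall i, N %| e i + (a i + a (ord_pred i))]%N =
    [forall i, a i + a (ord_pred i) == m i + m (ord_pred i) %[mod N]]%N.
    by apply: eq_forallb => i; rewrite dvdn_subn_mod.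
  rewrite (fun_if ( *%R g@_a)) mulr0; over.
rewrite -big_mkcond -mulr_suml => /eqP.
by rewrite mulf_eq0 signr_eq0 orbF => /eqP.
Qed.

End CycleToric.

Theorem theorem5p9 (K : finFieldType) (k : nat)
    (hq : (2 < #|K|)%N) (hk : (2 <= k)%N) :
  forall p : {mpoly K[2 * k]},
    vanishing_ideal (toric_set (@cycle_edge (2 * k))) p
    <-> ideal_gen (@cycle_generator K (2 * k)) p.
Proof.
have k_gt0 : (0 < k)%N by apply: leq_trans hk.
move=> p; split; last first.
  move=> [m [c [g [Gg ->]]]]; exists m, c, g; split=> // i; split.
    exact: cycle_generator_homog.
  by move=> P; apply: cycle_generator_vanishes.
move=> [m [c [g [Gg ->]]]]; apply: ideal_gen_sum => i _; apply: ideal_genM.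
have [[d /dhomogP homg] vang] := Gg i.
have N_gt0 : (0 < #|K| - 1)%N by rewrite subn_gt0 ltnW.
(* [h] records the torus character of t^a. Residues lie below N, so [inord] into the successor type
   preserves them. *)
pose h (a : 'X_{1..2 * k}) : {ffun 'I_(2 * k) -> 'I_(#|K| - 1).+1} :=
  [ffun j => inord ((a j + a (ord_pred j)) %% (#|K| - 1))].
have hE a b : (h a == h b) = [forall j, a j + a (ord_pred j) ==
                 b j + b (ord_pred j) %[mod #|K| - 1]].
  apply/eqP/forallP => [/ffunP hab j|ab].
    have /(congr1 val) := hab j; rewrite !ffunE /= !inordK ?ltnS 1?ltnW ?ltn_mod //.
    by move=> ->.
  by apply/ffunP => j; rewrite !ffunE (eqP (ab j)).
apply: (@ideal_gen_fibres _ _ _ _ h) => [a ga|a b ga gb].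
  under eq_bigl => b do rewrite hE.
  by apply: toric_coef_sum_eq0 => x x0; apply: toric_set_eval_eq0.
move/eqP; rewrite hE => /forallP ab.
apply: congr_monomials => // [|j]; first by rewrite (homg a) ?(homg b).
exact/eqP.
Qed.
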